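(* Let $\alpha,\beta,\mu$ be real parameters with $\beta>0$ and $\mu\neq0$. The delay-differential equation $\dot x(t)=Ax(t)+Bx(t-\tau)$ with $$A=\begin{pmatrix}\alpha&\beta\\-\beta&\alpha\end{pmatrix},\qquad B=\begin{pmatrix}\mu&0\\0&\mu\end{pmatrix}$$ belongs to the universality class II if and only if $$|\alpha|<|\mu|,\qquad \alpha^2+\beta^2>\mu^2.$$
   Context: Generating polynomial: $p_\omega(Y)=\det[i\omega I-A-BY]$. Asymptotic continuous spectrum (ACS): the collection of curves $\left\{\frac1\tau\gamma_j(\omega)+i\omega\right\}$, $\omega\in\mathbb{R}$, $j=1,\dots,m$, where $\gamma_j(\omega)=-\ln|Y_j(\omega)|$ and $Y_j(\omega)$ are the roots of the generating polynomial, $p_\omega(Y_j(\omega))=0$. Points $\omega$ for which the polynomial is degenerate, i.e. $p_\omega(Y)\equiv\det[i\omega I-A]$ for all $Y$, are excluded. A branch of the ACS is one of the functions $\gamma_j$. Universality class II: the ACS (and the DDE) is of universality class II if there exist real numbers $\omega_{H_1}>\omega_{H_2}>0$ such that for some $j,h\in\mathbb{N}$ (possibly equal): (i) $\gamma_j(\omega_{H_m})=0$ $(m=1,2)$ and $\gamma_j(\omega)>0$ for all $\omega\in(\omega_{H_2},\omega_{H_1})$; (ii) $\gamma_h(-\omega_{H_m})=0$ $(m=1,2)$ and $\gamma_h(\omega)>0$ for all $\omega\in(-\omega_{H_1},-\omega_{H_2})$; (iii) $\omega_{H_m}$ and $-\omega_{H_m}$ are regular points of $\gamma_j$ and $\gamma_h$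 respectively, i.e. $\frac{d}{d\omega}\gamma_h(-\omega_{H_m})$ and $\frac{d}{d\omega}\gamma_j(\omega_{H_m})$ exist and are nonzero; (iv) for all remaining values of $\omega$ and branches of the ACS not mentioned in (i)-(iii), the ACS is negative. *)

(* Defs.v *)
From HB Require Import structures.
From mathcomp Require Import all_boot all_order all_algebra.
From mathcomp Require Import complex.
From mathcomp Require Import all_classical all_reals all_analysis.

Set Implicit Arguments.
Unset Strict Implicit.
Unset Printing Implicit Defensive.

Import Order.TTheory GRing.Theory Num.Theory.
Import numFieldNormedType.Exports.

Local Open Scope classical_set_scope.
Local Open Scope ring_scope.

Definition mx22 (R : Type) (a b c d : R) : 'M[R]_2 :=
  \matrix_(i < 2, j < 2)
    if i == ord0 then (if j == ord0 then a else b)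
    else (if j == ord0 then c else d).

Section AsymptoticContinuousSpectrum.
Variables (R : realType) (n : nat).
(* Coefficients of the equation x'(t) = A x(t) + B x(t - tau). *)
Variables (A B : 'M[R]_n).

Definition complex_mx (M : 'M[R]_n) : 'M[R[i]]_n := map_mx (real_complex R) M.

(* i w I - A *)
Definition char_mx0 (w : R) : 'M[R[i]]_n := (0 +i* w)%C%:M - complex_mx A.

(* det (i w I - A - B Y), as a polynomial in Y. *)
Definition gen_poly (w : R) : {poly R[i]} :=
  \det (map_mx polyC (char_mx0 w) - 'X *: map_mx polyC (complex_mx B)).

Definition degenerate (w : R) : Prop := gen_poly w = (\det (char_mx0 w))%:P.

(* The degree of [gen_poly w] may drop for some w, in which case a root leaves
   to infinity; the root functions therefore take values in the Riemann sphere,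
   with [None] as the point at infinity. The cast selects the norm topology. *)
Definition sphere : topologicalType :=
  one_point_compactification (R[i] : numFieldType).

Definition lin_factor (y : sphere) : {poly R[i]} :=
  if y is Some z then 'X - z%:P else 1.

(* Enumeration, with multiplicity, of the roots of the generating polynomial by
   functions Y_j which are continuous away from the degenerate points. *)
Definition root_branches (m : nat) (Y : 'I_m -> R -> sphere) : Prop :=
  forall w : R, ~ degenerate w ->
    gen_poly w =
      lead_coef (gen_poly w) *:
        \prod_(j < m) lin_factor (Y j w)
    /\ forall j : 'I_m, {for w, continuous (Y j)}.

(* - ln |y|; it is +oo at y = 0 and -oo at y = infinity. *)
Definition minus_ln_norm (y : sphere) : \bar R :=
  if y is Some z then (- lne (ComplexField.Normc.normc z)%:E)%E else -oo%E.

Definition acs_branch (m : nat) (Y : 'I_m -> R -> sphere) (j : 'I_m) (w : R)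
    : \bar R :=
  minus_ln_norm (Y j w).

Definition regular_point (g : R -> \bar R) (w : R) : Prop :=
  derivable (fine \o g) w 1 /\ derive1 (fine \o g) w != 0.

(* Degenerate points do not belong to the spectrum, so all frequencies below
   range over the non-degenerate ones. A branch staying at infinity has value
   -oo, hence imposes nothing, so m may exceed the degree of gen_poly. *)
Definition universality_class_II : Prop :=
  exists (m : nat) (Y : 'I_m -> R -> sphere), root_branches Y /\
  let gamma := acs_branch Y in
  exists wH1 wH2 : R, [/\ 0 < wH2, wH2 < wH1 &
  exists j h : 'I_m,
  [/\ (forall w : R, w \in [:: wH1; wH2] ->
         ~ degenerate w /\ gamma j w = 0%E)
      /\ (forall w : R, ~ degenerate w -> wH2 < w < wH1 -> (0 < gamma j w)%E),
      (forall w : R, w \in [:: - wH1; - wH2] ->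
         ~ degenerate w /\ gamma h w = 0%E)
      /\ (forall w : R, ~ degenerate w -> - wH1 < w < - wH2 ->
            (0 < gamma h w)%E),
      (forall w : R, w \in [:: wH1; wH2] ->
         regular_point (gamma j) w /\ regular_point (gamma h) (- w))
    & forall (k : 'I_m) (w : R), ~ degenerate w ->
        ~ (k = j /\ wH2 <= w <= wH1) ->
        ~ (k = h /\ - wH1 <= w <= - wH2) ->
        (gamma k w < 0)%E]].

End AsymptoticContinuousSpectrum.

(* Main.v *)
Require Import Defs.
From mathcomp Require Import all_boot all_order all_algebra.
From mathcomp Require Import all_classical all_reals all_analysis.
From mathcomp Require Import complex ring lra.

(* The generating polynomial is (i w - alpha - mu Y)^2 + beta^2, which is never
   degenerate; its roots are Y_c = (i (w - c) - alpha) / mu for c = beta and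
   c = - beta, with |Y_c|^2 = (alpha^2 + (w - c)^2) / mu^2. Hence -ln |Y_c| is
   positive exactly when alpha^2 + (w - c)^2 < mu^2, which for |alpha| < |mu| is
   the interval with centre c and half-width s = sqrt (mu^2 - alpha^2), and the
   two intervals avoid the frequency 0 exactly when s < beta. Conversely a
   branch positive somewhere forces |alpha| < |mu|, and negativity of the whole
   spectrum at w = 0 gives mu^2 < alpha^2 + beta^2. *)

Import Order.TTheory GRing.Theory Num.Theory.
Import numFieldNormedType.Exports.
Local Open Scope ring_scope.

Lemma root_lin_factor (R : realType) (y : sphere R) (z : R[i]) :
  root (lin_factor y) z = (y == Some z :> option R[i]).
Proof.
case: y => [x|] /=; last by rewrite (negPf (root1 _)).
by rewrite root_XsubC eq_sym.
Qed.

(** Neither the nonzero leading coefficient nor the factor 1 of a branch at infinity contributes a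
    root, so only finite branch values remain. *)
Lemma root_gen_polyP (R : realType) (n : nat) (A B : 'M[R]_n) (m : nat)
    (Y : 'I_m -> R -> sphere R) (w : R) (z : R[i]) :
    root_branches A B Y -> ~ degenerate A B w -> gen_poly A B w != 0 ->
  root (gen_poly A B w) z <-> exists j, Y j w = Some z.
Proof.
move=> branchY nondeg_w gp_neq0; have [-> _] := branchY w nondeg_w.
rewrite rootZ ?lead_coef_eq0//.
rewrite (big_morph (root^~ z) (fun p q => rootM p q z) (negPf (root1 z))) big_orE.
split=> [/existsP[j]|[j Yj]]; first by rewrite root_lin_factor => /eqP; exists j.
by apply/existsP; exists j => /=; rewrite root_lin_factor Yj eqxx.
Qed.

Lemma continuous_complex (R : realType) (a b : R -> R) (w : R) :
    {for w, continuous a} -> {for w, continuous b} ->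
  {for w, continuous (fun x => (a x +i* b x)%C : (R[i] : numFieldType))}.
Proof.
move=> ca cb; apply/cvgrPdist_lt => /= e; rewrite ltcE /= => /andP[/eqP ime ree].
(* A positive [e] in [R[i]] is real. Keeping both components within half of it bounds the squared
   modulus by [e ^+ 2 / 2]. *)
have r0 : 0 < complex.Re e / 2 by rewrite divr_gt0.
move/cvgrPdist_lt: ca => /(_ _ r0) na; move/cvgrPdist_lt: cb => /(_ _ r0) nb.
near=> x; rewrite normc_def ltcE /= ime eqxx /=.
have : `|a w - a x| < complex.Re e / 2 by near: x.
have : `|b w - b x| < complex.Re e / 2 by near: x.
rewrite !ltr_norml => /andP[b1 b2] /andP[a1 a2].
rewrite -[ltRHS]ger0_norm ?ltW// -sqrtr_sqr ltr_sqrt ?exprn_gt0//.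
nra.
Unshelve. all: by end_near. Qed.

Section Rotation.
Variables (R : realType) (alpha beta mu : R).
Hypothesis mu_neq0 : mu != 0.

Definition delay_root (c w : R) : R[i] := (- alpha / mu +i* ((w - c) / mu))%C.

Lemma mu2C_neq0 : (mu ^+ 2)%:C%C != 0 :> R[i].
Proof. by rewrite eq_complex /= eqxx andbT expf_eq0 (negPf mu_neq0). Qed.

Lemma gen_poly_mx22 (w : R) :
  gen_poly (mx22 alpha beta (- beta) alpha) (mx22 mu 0 0 mu) w =
  (mu ^+ 2)%:C%C *:
    (('X - (delay_root beta w)%:P) * ('X - (delay_root (- beta) w)%:P)).
Proof.
rewrite /gen_poly (expand_det_row _ ord0) !big_ord_recl big_ord0 /cofactor.
rewrite !det_mx11 !mxE /= !mulr1n !mulr0n !addn0 expr0 expr1 addr0.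
(* As [v ^+ 2 = - beta ^+ 2], the determinant is the difference of squares of [u - mu Y] and [v],
   with roots [(u - v) / mu] and [(u + v) / mu]. *)
set u := (0 +i* w)%C - alpha%:C%C; set v := (0 +i* beta)%C.
have mu1 : mu%:C%C * delay_root beta w = u - v.
  by apply/eqP; rewrite eq_complex /=; apply/andP; split; apply/eqP; field.
have mu2 : mu%:C%C * delay_root (- beta) w = u + v.
  by apply/eqP; rewrite eq_complex /=; apply/andP; split; apply/eqP; field.
have v2 : v%:P * v%:P + beta%:C%C%:P * beta%:C%C%:P = 0 :> {poly R[i]}.
  rewrite -!polyCM -polyCD; apply/eqP; rewrite polyC_eq0 eq_complex /=.
  by apply/andP; split; apply/eqP; ring.
rewrite -mul_polyC expr2 !rmorphM /= -[RHS]/(_ * _ * _).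
transitivity (('X * mu%:C%C%:P - (u - v)%:P) * ('X * mu%:C%C%:P - (u + v)%:P));
  last by rewrite -mu1 -mu2 !polyCM; ring.
(* The two sides differ by exactly the left side of [v2]; writing 0 in that form leaves a ring
   identity. *)
apply/eqP; rewrite -subr_eq0 -v2 !sub0r !rmorphN !rmorph0 !polyCD !polyCN.
by apply/eqP; ring.
Qed.

Lemma nondegenerate_mx22 (w : R) :
  ~ degenerate (mx22 alpha beta (- beta) alpha) (mx22 mu 0 0 mu) w.
Proof.
rewrite /degenerate gen_poly_mx22 => /(congr1 (size \o polyseq)) /=.
rewrite size_scale ?mu2C_neq0// size_mul ?polyXsubC_eq0// !size_XsubC.
by rewrite size_polyC; case: (_ != 0).
Qed.

(** Serves the forward direction, where the enumeration [Y] is arbitrary and only its set of finite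
    values is known. *)
Lemma root_branches_mx22P (m : nat) (Y : 'I_m -> R -> sphere R) (w : R)
    (z : R[i]) :
    root_branches (mx22 alpha beta (- beta) alpha) (mx22 mu 0 0 mu) Y ->
  (z == delay_root beta w) || (z == delay_root (- beta) w) <->
  exists j, Y j w = Some z.
Proof.
move=> branchY; rewrite -!root_XsubC -rootM -(rootZ _ _ mu2C_neq0).
rewrite -gen_poly_mx22; apply: root_gen_polyP => //.
  exact: nondegenerate_mx22.
by rewrite gen_poly_mx22 scaler_eq0 mulf_eq0 !polyXsubC_eq0 (negPf mu2C_neq0).
Qed.

(** The squared modulus of [delay_root c w], polynomial in [w]. *)
Definition delay_root_norm2 (c w : R) : R :=
  (alpha ^+ 2 + (w - c) ^+ 2) / mu ^+ 2.

Lemma normc_delay_root (c w : R) :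
  ComplexField.Normc.normc (delay_root c w) = Num.sqrt (delay_root_norm2 c w).
Proof.
rewrite /delay_root /delay_root_norm2 /=; congr Num.sqrt.
by field.
Qed.

Lemma minus_ln_norm_delay_root_gt0 (c w : R) :
  (0 < minus_ln_norm (Some (delay_root c w)))%E =
  (alpha ^+ 2 + (w - c) ^+ 2 < mu ^+ 2).
Proof.
rewrite /minus_ln_norm oppe_gt0 lne_lt0 normc_delay_root.
rewrite lte_fin -[X in _ < X]sqrtr1 ltr_sqrt// /delay_root_norm2.
by rewrite ltr_pdivrMr ?mul1r// exprn_even_gt0.
Qed.

Lemma minus_ln_norm_delay_root_lt0 (c w : R) :
  (minus_ln_norm (Some (delay_root c w)) < 0)%E =
  (mu ^+ 2 < alpha ^+ 2 + (w - c) ^+ 2).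
Proof.
rewrite /minus_ln_norm oppe_lt0 lne_gt0 normc_delay_root.
rewrite lte_fin -[X in X < _]sqrtr1 /delay_root_norm2.
have mu2 : 0 < mu ^+ 2 by rewrite exprn_even_gt0.
(* Strict comparison of square roots needs a positive larger side, which [h] supplies; in the other
   case both sides are false. *)
have [h|h] := ltP (mu ^+ 2).
  rewrite ltr_sqrt ?ltr_pdivlMr ?mul1r// (lt_trans _ h)//.
  by rewrite mul0r.
by apply/negbTE; rewrite -leNgt ler_wsqrtr// ler_pdivrMr// mul1r.
Qed.

Lemma continuous_delay_root (c : R) :
  continuous (fun w => Some (delay_root c w) : sphere R).
Proof.
move=> w.
apply: (@continuous_comp _ _ _ (delay_root c : R -> (R[i] : numFieldType))).
  apply: continuous_complex; first exact: cst_continuous.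
  by apply: cvgM; [apply: cvgB; [exact: cvg_id|exact: cvg_cst]|exact: cvg_cst].
exact: one_point_compactification_some_continuous.
Qed.

(** With [q] the squared modulus, the branch is [- ln q / 2], whose derivative is a nonzero multiple
    of [w - c]. *)
Lemma regular_delay_root (c w : R) : w != c ->
  regular_point (fun x => minus_ln_norm (Some (delay_root c x))) w.
Proof.
move=> wc.
have q_gt0 : 0 < delay_root_norm2 c w.
  rewrite divr_gt0 ?exprn_even_gt0// ltr_wpDl ?sqr_ge0//.
  by rewrite exprn_even_gt0// subr_eq0.
(* Also true at a zero of delay_root, where fine +oo = 0 and ln 0 = 0. *)
have fineE : fine \o (fun x => minus_ln_norm (Some (delay_root c x)))
   = (fun x => - (2^-1 * ln (delay_root_norm2 c x))).
  apply/funext => x; rewrite /comp /minus_ln_norm normc_delay_root.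
  have : 0 <= delay_root_norm2 c x.
    by rewrite divr_ge0 ?addr_ge0 ?sqr_ge0.
  rewrite le0r => /predU1P[->|q0].
    by rewrite sqrtr0 le0_lneNy// ln0// mulr0 oppr0.
  rewrite lne_EFin ?sqrtr_gt0//= -[in RHS](sqr_sqrtr (ltW q0)).
  by rewrite lnXn ?sqrtr_gt0// mulr2n; field.
have dq : is_derive w 1 (delay_root_norm2 c) (2 * (w - c) / mu ^+ 2).
  rewrite /delay_root_norm2.
  apply: is_derive_eq.
  by rewrite scaler0 add0r add0r mul1r subr0 /GRing.scale /=; field.
have dln := is_derive1_comp (is_derive1_ln q_gt0) dq.
have dg : is_derive w 1
    (fine \o (fun x => minus_ln_norm (Some (delay_root c x))))
    (- (2^-1 * ((delay_root_norm2 c w)^-1 * (2 * (w - c) / mu ^+ 2)))).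
  rewrite fineE; apply: is_deriveN; exact: is_deriveZ.
split; first exact: ex_derive.
rewrite derive1E derive_val oppr_eq0 !mulf_neq0 ?invr_eq0 ?subr_eq0 ?expf_neq0//.
by rewrite gt_eqF.
Qed.
End Rotation.

Theorem proposition5p2 (R : realType) (alpha beta mu : R)
    (hbeta : 0 < beta) (hmu : mu != 0) :
  universality_class_II (mx22 alpha beta (- beta) alpha) (mx22 mu 0 0 mu) <->
  `|alpha| < `|mu| /\ mu ^+ 2 < alpha ^+ 2 + beta ^+ 2.
Proof.
split.
  move=> [m [Y [branchY [w1 [w2 [w2_gt0 w21 [j [h [[_ posj] _ _ neg]]]]]]]]].
  split.
    have wm : w2 < (w1 + w2) / 2 < w1 by lra.
    have := posj _ (nondegenerate_mx22 _ _ _ _ hmu _) wm.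
    (* Positivity rules out the point at infinity, where the value is [-oo]. *)
    rewrite /acs_branch; case Yj : (Y j _) => [z|]//.
    have := (root_branches_mx22P _ alpha beta mu hmu m Y _ z branchY).2 (ex_intro _ j Yj).
    suff hc c : (0 < minus_ln_norm (Some (delay_root R alpha mu c ((w1 + w2) / 2))))%E ->
        `|alpha| < `|mu|.
      by case/orP => /eqP ->; apply: hc.
    rewrite minus_ln_norm_delay_root_gt0 // => ac.
    rewrite -ltr_sqr ?qualifE/= ?normr_ge0// !real_normK ?num_real//.
    by rewrite (le_lt_trans _ ac)// lerDl sqr_ge0.
  (* Some branch passes through this root at frequency 0, which lies outside both intervals because
     [0 < w2]. *)
  have [k Yk] := (root_branches_mx22P _ alpha beta mu hmu m Y 0
    (delay_root R alpha mu beta 0) branchY).1 ltac:(by rewrite eqxx).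
  have := neg k 0 (nondegenerate_mx22 _ _ _ _ hmu _).
  rewrite /acs_branch Yk minus_ln_norm_delay_root_lt0// sub0r sqrrN.
  by apply=> [[_]|[_]]; lra.
move=> [amu mub].
have amu2 : alpha ^+ 2 < mu ^+ 2.
  rewrite -[_ ^+ 2]real_normK ?num_real// -[ltRHS]real_normK ?num_real//.
  by rewrite ltr_sqr ?qualifE/= ?normr_ge0.
pose s := Num.sqrt (mu ^+ 2 - alpha ^+ 2).
have s0 : 0 < s by rewrite sqrtr_gt0 subr_gt0.
have s2 : s ^+ 2 = mu ^+ 2 - alpha ^+ 2 by rewrite sqr_sqrtr// subr_ge0 ltW.
(* This makes the lower endpoint [beta - s] positive. *)
have sb : s < beta by nra.
pose c (j : 'I_2) := if j == ord0 then beta else - beta.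
exists 2, (fun j w => Some (delay_root R alpha mu (c j) w)).
have zeroP d w : (w - d) ^+ 2 = s ^+ 2 ->
    minus_ln_norm (Some (delay_root R alpha mu d w)) = 0%E.
  move=> wd; apply/eqP; rewrite eq_le.
  rewrite !leNgt minus_ln_norm_delay_root_lt0// minus_ln_norm_delay_root_gt0//.
  by rewrite wd s2 addrC subrK !ltxx.
split.
  move=> w _; split; last by move=> j; exact: continuous_delay_root.
  rewrite gen_poly_mx22// lead_coefZ lead_coefM !lead_coefXsubC !mulr1.
  by rewrite !big_ord_recl big_ord0 mulr1.
have nd := nondegenerate_mx22 R alpha beta mu hmu.
exists (beta + s), (beta - s); split; [lra|lra|].
exists ord0, (lift ord0 ord0); rewrite /acs_branch /=; split.
- split=> w; last by move=> _ hw; rewrite minus_ln_norm_delay_root_gt0 ///c /=; nra.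
  rewrite !inE => hw; split=> //; apply: zeroP.
  by case/orP: hw => /eqP ->; rewrite /c /=; ring.
- split=> w; last by move=> _ hw; rewrite minus_ln_norm_delay_root_gt0 ///c /=; nra.
  rewrite !inE => hw; split=> //; apply: zeroP.
  by case/orP: hw => /eqP ->; rewrite /c /=; ring.
(* Each endpoint is at distance [s > 0] from its centre. *)
- move=> w; rewrite !inE => hw; split; apply: regular_delay_root => //;
  by apply/eqP; rewrite /c /=; case/orP: hw => /eqP ->; lra.
- move=> k w _ hj hh; rewrite minus_ln_norm_delay_root_lt0//.
  suff : s ^+ 2 < (w - c k) ^+ 2 by rewrite s2; lra.
  have outside d : ~ (d - s <= w <= d + s) -> s ^+ 2 < (w - d) ^+ 2.
    move/negP; rewrite negb_and -!ltNge => /orP[]; nra.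
  apply: outside => hw; have [k0|k0] := eqVneq k ord0.
    by apply: hj; move: hw; rewrite /c k0 eqxx; split.
  (* The only nonzero index of ['I_2] is that of the branch centred at [- beta]. *)
  apply: hh; split; first by apply: val_inj; case: k k0 {hj hw} => [[|[|]]].
  by move: hw; rewrite /c (negPf k0); lra.
Qed.
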